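(* Let $q$ be a power of an odd prime with $q\equiv 3 \pmod 4$, and let $d=4k+2$ with $k\in\mathbb N$ ($k\ge 1$). Let $S_0=\{x\in\mathbb F_q^d: x_1^2+\cdots+x_d^2=0\}$ with normalized surface measure $d\sigma$. Then for every $r$ with $\frac{2d+4}{d}\le r\le \infty$ there is a constant $C>0$ independent of $q$ such that for all functions $f:S_0\to\mathbb C$, $$\|(fd\sigma)^\vee\|_{L^r(\mathbb F_q^d,dm)}\le C\,\|f\|_{L^2(S_0,d\sigma)}.$$
   Context: $\chi$ denotes the canonical nontrivial additive character of $\mathbb F_q$. The space $\mathbb F_q^d$ carries counting measure $dm$, so $\|g\|_{L^r(\mathbb F_q^d,dm)}=(\sum_{m\in\mathbb F_q^d}|g(m)|^r)^{1/r}$. For a set $V\subset\mathbb F_q^d$ the normalized surface measure $d\sigma$ gives mass $|V|^{-1}$ to each point of $V$, so $\|f\|_{L^p(V,d\sigma)}=(|V|^{-1}\sum_{x\in V}|f(x)|^p)^{1/p}$ (with the usual max for $p=\infty$), and $(fd\sigma)^\vee(m)=\frac{1}{|V|}\sum_{x\in V}f(x)\chi(m\cdot x)$ for $m\in\mathbb F_q^d$. *)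

(* Defs.v *)
From HB Require Import structures.
From mathcomp Require Import all_boot all_order all_algebra all_field.
From mathcomp Require Import all_classical all_reals all_analysis.
From mathcomp Require Import complex.
Set Implicit Arguments. Unset Strict Implicit. Unset Printing Implicit Defensive.
Import Order.TTheory GRing.Theory Num.Theory.
Local Open Scope ring_scope.

Section FFExt.
Variables (R : realType) (F : finFieldType) (p n d : nat).

Definition dotF (m x : 'rV[F]_d) : F := \sum_(i < d) m ord0 i * x ord0 i.

Definition S0 : {set 'rV[F]_d} := [set x : 'rV[F]_d | \sum_(i < d) x ord0 i ^+ 2 == 0].

Definition absTr (x : F) : F := \sum_(i < n) x ^+ (p ^ i).

(* the integer t in {0,..,p-1} with t%:R = Tr x (Tr x lies in the prime field) *)
Definition trnat (x : F) : nat := find (fun t => t%:R == absTr x) (iota 0 p).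

Definition chi (x : F) : R[i] :=
  let th := 2 * pi * (trnat x)%:R / p%:R in (cos th +i* sin th)%C.

Definition extension (f : 'rV[F]_d -> R[i]) (m : 'rV[F]_d) : R[i] :=
  (#|S0|%:R)^-1 * \sum_(x in S0) f x * chi (dotF m x).

Definition L2_S0 (f : 'rV[F]_d -> R[i]) : R :=
  Num.sqrt ((#|S0|%:R)^-1 * \sum_(x in S0) ComplexField.Normc.normc (f x) ^+ 2).

Definition Lr_count (r : \bar R) (g : 'rV[F]_d -> R[i]) : R :=
  match r with
  | EFin r' => (\sum_(m : 'rV[F]_d) ComplexField.Normc.normc (g m) `^ r') `^ r'^-1
  | +oo%E => \big[Order.max/0]_(m : 'rV[F]_d) ComplexField.Normc.normc (g m)
  | -oo%E => 0
  end.
End FFExt.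

(* Main.v *)
Require Import Defs.
From HB Require Import structures.
From mathcomp Require Import all_boot all_order all_algebra all_field.
From mathcomp Require Import all_classical all_reals all_analysis.
From mathcomp Require Import complex.
From mathcomp Require Import zify ring lra.
Import Order.TTheory GRing.Theory Num.Theory.
Local Open Scope ring_scope.
Set Implicit Arguments. Unset Strict Implicit. Unset Printing Implicit Defensive.
Local Notation normc := ComplexField.Normc.normc.

(* Write q = |F|, d = 2e with e odd, and S for the zero sphere. As -1 is not a
   square, the Gauss sums satisfy G_t^2 = -q, and since e is odd the Fourier
   transform of the indicator of S is
     q^(d-1) [m = 0] - q^e [m in S] + q^(e-1).
   The middle term is negative, so for g >= 0 expanding the square gives
     |S|^-1 sum_S |g^|^2 <= 2 (sum g^2 + q^-e (sum g)^2),
   without the loss that the decay of the transform alone would produce;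
   Plancherel gives |S|^-1 sum_S |g^|^2 <= 2 q sum g^2 for every g.
   Let f have L^2 norm at most 1, h its extension (so |h| <= 1), a = 4/d and
   v = max (Re h) 0. Pairing h with v^(1+a), cut at the level v = 4 q^(-d/4),
   and using the first bound above the level and the second one below it,
   bounds sum v^(2+a) by a constant. The rotations of f by the fourth roots of
   unity then control all of |h|, and |h| <= 1 gives the exponents r > 2 + a. *)

(** * The absolute trace and its representative in the prime field *)

Lemma natr_eq_pchar (F : finFieldType) (p a b : nat) :
  p \in [pchar F] -> (a%:R == b%:R :> F) = (a == b %[mod p]).
Proof.
move=> pF; wlog ab : a b / (a <= b)%N => [H|].
  by case/orP: (leq_total a b) => /H //; rewrite eq_sym => ->; rewrite eq_sym.
rewrite eq_sym -subr_eq0 -natrB // -(dvdn_pcharf pF).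
by rewrite [RHS]eq_sym eqn_mod_dvd.
Qed.

Section Trace.
Variables (F : finFieldType) (p n : nat).
Hypotheses (p_prime : prime p) (n_gt0 : (0 < n)%N) (cardF : #|F| = (p ^ n)%N).

Let pF : p \in [pchar F]. Proof. exact: card_finPcharP cardF p_prime. Qed.

Lemma absTrD (x y : F) : absTr p n (x + y) = absTr p n x + absTr p n y.
Proof.
rewrite /absTr -big_split; apply: eq_bigr => i _ /=.
rewrite exprDn_pchar // pnatX; apply/orP; left.
by rewrite pnatE.
Qed.

(** Frobenius shifts the summands cyclically, the last one returning to [x] because [x^(p^n) = x].
    This places the trace in the prime field. *)
Lemma absTr_frob (x : F) : absTr p n x ^+ p = absTr p n x.
Proof.
rewrite /absTr -(pFrobenius_autE pF) rmorph_sum /=.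
case: n n_gt0 cardF => // m _ cF.
rewrite big_ord_recr big_ord_recl /= addrC; congr (_ + _).
  by rewrite pFrobenius_autE -exprM -expnSr -cF expf_card expn0 expr1.
by apply: eq_bigr => i _; rewrite pFrobenius_autE -exprM -expnSr.
Qed.

(** The trace is a nonzero polynomial of degree at most [p^(n-1)], too small to vanish at all [p^n]
    points of [F]. *)
Lemma absTr_neq0 : exists x : F, absTr p n x != 0.
Proof.
pose P : {poly F} := \sum_(i < n) 'X^(p ^ i).
have Px x : P.[x] = absTr p n x.
  by rewrite horner_sum; apply: eq_bigr => i _; rewrite hornerXn.
have P0 : P != 0.
  apply/eqP => /(congr1 (fun Q : {poly F} => Q`_1)); rewrite coef0 coef_sum.
  case: n n_gt0 => // m _; rewrite big_ord_recl expn0 coefXn eqxx big1 ?addr0.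
    by move/eqP; rewrite oner_eq0.
  move=> i _; rewrite coefXn -(expn0 p) eqn_exp2l ?prime_gt1 //.
have sP : (size P <= (p ^ n.-1).+1)%N.
  apply: leq_trans (size_sum _ _ _) _; apply/bigmax_leqP => i _.
  rewrite size_polyXn ltnS leq_exp2l ?prime_gt1 //.
  by rewrite -ltnS (ltn_predK n_gt0).
apply/existsP; apply: contraT; rewrite negb_exists => /forallP H.
have rs : all (root P) (enum F).
  by apply/allP => x _; rewrite rootE Px; have := H x; rewrite negbK.
have := leq_trans (max_poly_roots P0 rs (enum_uniq _)) sP.
rewrite -cardE cardF ltnS leq_exp2l ?prime_gt1 //.
by rewrite -{1}(ltn_predK n_gt0) ltnn.
Qed.

(** The images of [0, ..., p-1] are already [p] distinct roots of [X^p - X]; any other [y] would be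
    one root too many. *)
Lemma natr_of_frob (y : F) : y ^+ p = y -> exists2 t, (t < p)%N & t%:R = y.
Proof.
move=> yp; pose P : {poly F} := 'X^p - 'X.
have sP : size P = p.+1.
  by rewrite size_polyDl size_polyXn // size_polyN size_polyX ltnS prime_gt1.
have P0 : P != 0 by rewrite -size_poly_eq0 sP.
pose s : seq F := [seq t%:R | t <- iota 0 p].
have [/mapP[t]|ys] := boolP (y \in s).
  by rewrite mem_iota => tp ->; exists t.
have us : uniq (y :: s).
  rewrite /= ys map_inj_in_uniq ?iota_uniq // => a b.
  rewrite !mem_iota !add0n /= => ap bp /eqP.
  by rewrite (natr_eq_pchar _ _ pF) !modn_small // => /eqP.
have rs : all (root P) (y :: s).
  rewrite /= rootE !hornerE yp subrr eqxx /=.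
  apply/allP => _ /mapP[t _ ->]; rewrite rootE !hornerE.
  by rewrite -(pFrobenius_autE pF) rmorph_nat subrr.
by have := max_poly_roots P0 rs us; rewrite sP /= size_map size_iota ltnn.
Qed.

Lemma trnatP (x : F) : (trnat p n x < p)%N /\ (trnat p n x)%:R = absTr p n x.
Proof.
have [t tp tx] := natr_of_frob (absTr_frob x).
have h : has (fun t => t%:R == absTr p n x) (iota 0 p).
  by apply/hasP; exists t; rewrite ?mem_iota //; apply/eqP.
(* A failed [find] would return [p], so this bound says that the search succeeds. *)
have lt : (trnat p n x < p)%N by move: (h); rewrite has_find size_iota.
split=> //; have /eqP := nth_find 0%N h.
by rewrite nth_iota.
Qed.

Lemma trnatD (x y : F) :
  trnat p n (x + y) = ((trnat p n x + trnat p n y) %% p)%N.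
Proof.
have [l e] := trnatP (x + y).
have : (trnat p n (x + y))%:R == (trnat p n x + trnat p n y)%:R :> F.
  by rewrite natrD e absTrD (trnatP x).2 (trnatP y).2.
by rewrite (natr_eq_pchar _ _ pF) modn_small // => /eqP.
Qed.

End Trace.

(** * The canonical additive character *)

Section Character.
Variables (R : realType) (F : finFieldType) (p n : nat).
Hypotheses (p_prime : prime p) (n_gt0 : (0 < n)%N) (cardF : #|F| = (p ^ n)%N).

(* The period of [t |-> exp (2 pi i t / p)] makes [chi] additive although [trnat]
   is additive only modulo p. *)
Definition rootU (t : nat) : R[i] :=
  let th : R := 2 * pi * t%:R / p%:R in (cos th +i* sin th)%C.

Lemma rootUD a b : rootU (a + b) = rootU a * rootU b.
Proof.
rewrite /rootU natrD mulrDr mulrDl cosD sinD.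
by apply/eqP; rewrite eq_complex /=; apply/andP; split; apply/eqP; ring.
Qed.

Lemma rootUp : rootU p = 1.
Proof.
rewrite /rootU -mulrA divff ?pnatr_eq0 ?gtn_eqF ?prime_gt0 // mulr1.
by rewrite mulr_natl cos2pi sin2pi.
Qed.

Lemma rootU_mod a : rootU (a %% p) = rootU a.
Proof.
rewrite {2}(divn_eq a p) rootUD; move: (a %/ p)%N => k.
suff -> : rootU (k * p) = 1 by rewrite mul1r.
elim: k => [|k IH]; last by rewrite mulSn rootUD rootUp IH mulr1.
by rewrite mul0n /rootU mulr0 mul0r cos0 sin0.
Qed.

Lemma chiD (x y : F) : chi R p n (x + y) = chi R p n x * chi R p n y.
Proof. by rewrite -rootUD -rootU_mod -trnatD. Qed.

Lemma chi_conj (x : F) : chi R p n x * conjc (chi R p n x) = 1.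
Proof.
rewrite /chi; set t := (X in cos X); apply/eqP; rewrite eq_complex /=.
rewrite mulrN opprK -!expr2 cos2Dsin2 eqxx /=.
by apply/eqP; ring.
Qed.

Lemma rootU_neq1 t : (0 < t < p)%N -> rootU t != 1.
Proof.
move=> /andP[t0 tp]; apply/eqP => /(congr1 (@complex.Re R)) /=.
have p0 : 0 < p%:R :> R by rewrite ltr0n prime_gt0.
set th := (X in cos X); pose u : R := pi * t%:R / p%:R.
(* The half angle [u] lies strictly between 0 and pi, so [cos (2 u) = 1 - 2 sin^2 u < 1]. *)
have -> : th = u *+ 2 by rewrite /th /u -mulr_natl; ring.
have : 0 < sin u.
  apply: sin_gt0_pi; rewrite /u; apply/andP; split.
    by rewrite divr_gt0 // mulr_gt0 ?pi_gt0 // ltr0n.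
  by rewrite ltr_pdivrMr // ltr_pM2l ?pi_gt0 // ltr_nat.
rewrite cos_mulr2n; have := cos2Dsin2 u.
nra.
Qed.

Lemma chi_nontrivial : exists x : F, chi R p n x != 1.
Proof.
have [x Tx] := absTr_neq0 p_prime n_gt0 cardF; exists x.
have [lt e] := trnatP p_prime n_gt0 cardF x.
apply: rootU_neq1; rewrite lt andbT lt0n; apply: contraNneq Tx => t0.
by rewrite -e t0.
Qed.

End Character.

(** * Factoring sums over vectors, and moduli of complex numbers *)

Lemma prod_sum_rV (A : comNzRingType) (T : finType) d (G : 'I_d -> T -> A) :
  \prod_(i < d) \sum_(a : T) G i a =
  \sum_(x : 'rV[T]_d) \prod_(i < d) G i (x ord0 i).
Proof.
rewrite bigA_distr_bigA (reindex (fun x : 'rV[T]_d => [ffun i => x ord0 i])) /=.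
  by apply: eq_bigr => x _; apply: eq_bigr => i _; rewrite ffunE.
exists (fun f : {ffun 'I_d -> T} => \row_i f i) => [x _|f _].
  by apply/rowP => i; rewrite mxE ffunE.
by apply/ffunP => i; rewrite ffunE mxE.
Qed.

Lemma sqr_normc (R : rcfType) (z : R[i]) : (normc z ^+ 2)%:C%C = z * conjc z.
Proof.
case: z => a b; apply/eqP; rewrite eq_complex /= sqr_sqrtr ?addr_ge0 ?sqr_ge0 //.
by apply/andP; split; apply/eqP; ring.
Qed.

Lemma normc_ge0 (R : rcfType) (z : R[i]) : 0 <= normc z.
Proof. by case: z => a b; apply: sqrtr_ge0. Qed.

Lemma normc_Re (R : rcfType) (z : R[i]) : `|complex.Re z| <= normc z.
Proof.
case: z => a b; rewrite /= -sqrtr_sqr ler_sqrt ?addr_ge0 ?sqr_ge0 //.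
by rewrite lerDl sqr_ge0.
Qed.

(** * Gauss sums and the Fourier transform of the zero sphere *)

Section Gauss.
Variables (R : realType) (F : finFieldType) (psi : F -> R[i]).
Hypotheses (psiD : forall x y, psi (x + y) = psi x * psi y)
  (psiJ : forall x, psi x * conjc (psi x) = 1)
  (psi_nontrivial : exists x, psi x != 1).

Local Notation q := (#|F|).

Lemma psi0 : psi 0 = 1.
Proof.
have /(congr1 (fun z => z * conjc (psi 0))) := psiD 0 0.
by rewrite addr0 -mulrA psiJ mulr1.
Qed.

Lemma psiN x : psi (- x) = conjc (psi x).
Proof. by rewrite -[RHS]mul1r -psi0 -(addNr x) psiD -mulrA psiJ mulr1. Qed.

Lemma normc_psi x : normc (psi x) = 1.
Proof.
have /eqP : normc (psi x) ^+ 2 = 1.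
  by apply: complexI; rewrite sqr_normc psiJ.
by rewrite sqrp_eq1 ?normc_ge0 // => /eqP.
Qed.

Lemma psi_sum (I : finType) (P : pred I) (f : I -> F) :
  psi (\sum_(i | P i) f i) = \prod_(i | P i) psi (f i).
Proof. by apply: (big_morph psi psiD psi0). Qed.

Lemma sum_psi c : \sum_x psi (c * x) = if c == 0 then q%:R else 0.
Proof.
have [->|c0] := eqVneq c 0.
  rewrite (eq_bigr (fun _ => 1)) => [|x _]; last by rewrite mul0r psi0.
  by rewrite sumr_const.
have [a a1] := psi_nontrivial.
(* Translating [x] by [a / c] multiplies the sum by [psi a], which is not 1, so the sum must
   vanish. *)
have H : psi a * \sum_x psi (c * x) = \sum_x psi (c * x).
  rewrite [RHS](reindex_inj (addrI (c^-1 * a))) /= mulr_sumr.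
  by apply: eq_bigr => x _; rewrite -psiD mulrDr mulVKf.
have /eqP : (psi a - 1) * \sum_x psi (c * x) = 0.
  by rewrite mulrBl mul1r H subrr.
by rewrite mulf_eq0 subr_eq0 (negPf a1) => /eqP.
Qed.

Lemma sum_psi_dot d (m : 'rV[F]_d) :
  \sum_(x : 'rV[F]_d) psi (dotF m x) = if m == 0 then q%:R ^+ d else 0.
Proof.
under eq_bigr do rewrite /dotF psi_sum.
rewrite -(prod_sum_rV (fun i a => psi (m ord0 i * a))).
under eq_bigr do rewrite sum_psi.
have [->|m0] := eqVneq m 0.
  under eq_bigr do rewrite mxE eqxx.
  by rewrite prodr_const card_ord.
have [i mi] : exists i, m ord0 i != 0.
  apply/existsP; apply: contraNT m0; rewrite negb_exists => /forallP H.
  by apply/eqP/rowP => i; rewrite mxE; have := H i; rewrite negbK => /eqP.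
by rewrite (bigD1 i) //= (negPf mi) mul0r.
Qed.

Definition gauss (t : F) : R[i] := \sum_x psi (t * x ^+ 2).

Hypotheses (two_neq0 : 2 != 0 :> F) (q_mod4 : (q %% 4 = 3)%N).

(** This is [(q - 1) / 2], written so that its oddness is visible. *)
Let e := (q %/ 4).*2.+1.

Let q_e : q = e.*2.+1.
Proof. by rewrite {1}(divn_eq q 4) q_mod4 /e -!muln2; lia. Qed.

Let eta_sqr (x : F) : x != 0 -> (x ^+ e) ^+ 2 = 1.
Proof.
move=> x0; apply: (mulfI x0).
by rewrite -exprM muln2 -exprS -q_e expf_card mulr1.
Qed.

(** Raising [x^2 = -1] to the odd power [e] would give [1 = -1]. *)
Lemma sqr_neqN1 (x : F) : x ^+ 2 != -1.
Proof.
apply/eqP => x2; have x0 : x != 0.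
  by apply: contra_eq_neq x2 => ->; rewrite expr0n eq_sym oppr_eq0 oner_eq0.
have := eta_sqr x0; rewrite -exprM mulnC exprM x2 -signr_odd /e /= odd_double.
move/eqP; rewrite expr1 -subr_eq0 -opprD oppr_eq0 => H.
by move: two_neq0; rewrite (_ : 2 = 1 + 1) // H.
Qed.

(* [x ^+ e] is the quadratic character, so this bijection replaces a nonzero x by
   x^2 or - x^2; it turns [gauss t + gauss (- t)] into full character sums. *)
Lemma eta_sqr_inj : injective (fun x : F => x ^+ e * x ^+ 2).
Proof.
have z0 (x : F) : x ^+ e * x ^+ 2 = 0 -> x = 0.
  by move/eqP; rewrite mulf_eq0 !expf_eq0 /= => /orP[] /eqP.
move=> x y /=; have [->|x0] := eqVneq x 0.
  by rewrite expr0n mul0r => /esym/z0.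
have [->|y0] := eqVneq y 0.
  by rewrite [in RHS]expr0n mul0r => /z0 x00; rewrite x00 eqxx in x0.
move=> exy; have : (x / y) ^+ e * (x / y) ^+ 2 = 1.
  rewrite !expr_div_n mulrACA exy -invfM mulfV //.
  by rewrite mulf_neq0 // expf_neq0.
have : x / y != 0 by rewrite mulf_neq0 ?invr_eq0.
set z := x / y => zn0 ez.
suff z1 : z = 1 by rewrite -[x](mulfVK y0) -/z z1 mul1r.
(* If [z^e = 1] then [z = 1] or [z = -1], the latter excluded by [(-1)^e = -1]. If [z^e = -1] then
   [z^2 = -1], which is impossible. *)
have /eqP := eta_sqr zn0; rewrite sqrf_eq1 => /orP[] /eqP ze.
  move: ez; rewrite ze mul1r => /eqP; rewrite sqrf_eq1 => /orP[] /eqP // zN.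
  move: ze; rewrite zN -signr_odd /e /= odd_double expr1 => H.
  by have := sqr_neqN1 1; rewrite H expr1n eqxx.
by move: ez (sqr_neqN1 z); rewrite ze mulN1r => /eqP; rewrite eqr_oppLR => ->.
Qed.

Lemma gaussN t : t != 0 -> gauss t + gauss (- t) = 0.
Proof.
move=> t0.
have H s : s != 0 -> \sum_x psi (s * (x ^+ e * x ^+ 2)) = 0.
  move=> s0; have := sum_psi s.
  by rewrite (negPf s0) (reindex_inj eta_sqr_inj).
transitivity (\sum_x psi (t * (x ^+ e * x ^+ 2)) +
    \sum_x psi (- t * (x ^+ e * x ^+ 2))); last first.
  by rewrite !H ?oppr_eq0 // addr0.
rewrite -!big_split /=; apply: eq_bigr => x _; have [->|x0] := eqVneq x 0.
  by rewrite !(expr0n, mulr0).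
have /eqP := eta_sqr x0; rewrite sqrf_eq1 => /orP[] /eqP ->.
  by rewrite !mul1r.
by rewrite addrC !mulN1r !mulrN !mulNr !opprK.
Qed.

(** With the second variable written as [x + y], the phase is linear in [x], and orthogonality
    leaves only [y = 0]. *)
Lemma gauss_mulN t : t != 0 -> gauss t * gauss (- t) = q%:R.
Proof.
move=> t0; rewrite /gauss mulr_suml.
transitivity (\sum_y \sum_x psi (- t * y ^+ 2) * psi (- 2 * t * y * x)).
  rewrite exchange_big /=; apply: eq_bigr => x _.
  rewrite mulr_sumr (reindex_inj (addrI x)) /=; apply: eq_bigr => y _.
  by rewrite -!psiD; congr psi; ring.
under eq_bigr do rewrite -mulr_sumr sum_psi.
rewrite (bigD1 0) //= mulr0 eqxx expr0n mulr0 psi0 mul1r big1 ?addr0 // => y y0.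
by rewrite !mulf_eq0 oppr_eq0 (negPf two_neq0) (negPf t0) (negPf y0) mulr0.
Qed.

Lemma gauss_sqr t : t != 0 -> gauss t ^+ 2 = - q%:R.
Proof.
move=> t0; have /eqP := gaussN t0; rewrite addr_eq0 => /eqP H.
by rewrite expr2 {1}H mulNr mulrC gauss_mulN.
Qed.

Let four_neq0 : 4 != 0 :> F.
Proof. by rewrite (natrM F 2 2) mulf_neq0. Qed.

(** Completing the square: [x] is translated by [- b / (2 t)]. *)
Lemma gauss_shift t b : t != 0 ->
  \sum_x psi (t * x ^+ 2 + b * x) = psi (b ^+ 2 * - (4 * t)^-1) * gauss t.
Proof.
move=> t0; have t2 : 2 * t != 0 by rewrite mulf_neq0.
rewrite /gauss mulr_sumr (reindex_inj (addIr (- (b / (2 * t))))) /=.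
by apply: eq_bigr => x _; rewrite -psiD; congr psi; field; rewrite t0 four_neq0 two_neq0.
Qed.

Variables (d l : nat).
Hypothesis (dl : d = (l.*2.+1).*2).

(** The sum factors over the coordinates, and [gauss t ^+ d = (- q)^(d/2) = - q^(d/2)] since
    [d/2 = 2 l + 1] is odd. The sign, the same for every [t], is what makes the sphere term of
    [fourier_S0] negative. *)
Lemma sum_psi_quad t (m : 'rV[F]_d) : t != 0 ->
  \sum_(x : 'rV[F]_d) psi (t * (\sum_(i < d) x ord0 i ^+ 2) + dotF m x) =
  - psi ((\sum_(i < d) m ord0 i ^+ 2) * - (4 * t)^-1) * q%:R ^+ l.*2.+1.
Proof.
move=> t0.
transitivity (\prod_(i < d) \sum_a psi (t * a ^+ 2 + m ord0 i * a)).
  rewrite prod_sum_rV; apply: eq_bigr => x _.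
  by rewrite mulr_sumr -big_split psi_sum.
under eq_bigr do rewrite gauss_shift //.
rewrite big_split /= prodr_const card_ord -psi_sum -mulr_suml.
have -> : gauss t ^+ d = (gauss t ^+ 2) ^+ l.*2.+1 by rewrite -exprM mul2n dl.
rewrite gauss_sqr // exprNn -signr_odd /= odd_double.
by rewrite expr1 mulN1r mulrN mulNr.
Qed.

Lemma fourier_S0 (m : 'rV[F]_d) :
  q%:R * \sum_(x in S0 F d) psi (dotF m x) =
  q%:R ^+ d *+ (m == 0) - q%:R ^+ l.*2.+1 * (q%:R *+ (m \in S0 F d) - 1).
Proof.
(* Membership in the sphere is detected by summing over the frequency [t]; the term [t = 0] yields
   the mass at [m = 0]. *)
transitivity (\sum_t \sum_(x : 'rV[F]_d)
    psi (t * (\sum_(i < d) x ord0 i ^+ 2) + dotF m x)).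
  rewrite exchange_big /= big_mkcond mulr_sumr; apply: eq_bigr => x _.
  transitivity ((\sum_t psi ((\sum_(i < d) x ord0 i ^+ 2) * t)) * psi (dotF m x)).
    by rewrite sum_psi inE; case: eqP => _; rewrite ?mulr0 ?mul0r.
  by rewrite mulr_suml; apply: eq_bigr => t _; rewrite psiD [t * _]mulrC.
rewrite (bigD1 0) //=; congr (_ + _).
  under eq_bigr do rewrite mul0r add0r.
  by rewrite sum_psi_dot; case: eqP => _; rewrite ?mulr1n ?mulr0n.
under eq_bigr do rewrite sum_psi_quad //.
rewrite -mulr_suml sumrN mulNr mulrC; congr (- (_ * _)).
rewrite inE; set c := \sum_(i < d) _.
have := sum_psi c; rewrite (bigD1 0) //= mulr0 psi0.
(* As the inverse of 0 is 0, this map is an involution of all of [F] fixing 0. It turns the sum over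
   nonzero [t] into a full character sum less its term at 0. *)
have h2 : involutive (fun t : F => - (4 * t)^-1).
  move=> t /=; rewrite mulrN invrN opprK invfM invrK mulrA mulVf ?mul1r //.
rewrite (reindex_inj (inv_inj h2)) /=.
rewrite (eq_bigl (fun t => t != 0)) => [|t]; last first.
  by rewrite oppr_eq0 invr_eq0 mulf_eq0 (negPf four_neq0).
move=> H; apply: (addrI 1); rewrite H addrC subrK.
by case: eqP.
Qed.

End Gauss.

(** * Cauchy-Schwarz and elementary facts on complex sums *)

Lemma cauchy_schwarz (R : realFieldType) (I : finType) (P : pred I) (a b : I -> R) :
  (\sum_(i | P i) a i * b i) ^+ 2 <=
  (\sum_(i | P i) a i ^+ 2) * (\sum_(i | P i) b i ^+ 2).
Proof.
(* By Lagrange's identity this is twice the difference of the two sides. *)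
have : 0 <= \sum_(i | P i) \sum_(j | P j) (a i * b j - a j * b i) ^+ 2.
  by apply: sumr_ge0 => i _; apply: sumr_ge0 => j _; apply: sqr_ge0.
have sqE i j : (a i * b j - a j * b i) ^+ 2 = a i ^+ 2 * b j ^+ 2 +
  b i ^+ 2 * a j ^+ 2 - 2 * ((a i * b i) * (a j * b j)) by ring.
under eq_bigr => i _ do under eq_bigr do rewrite sqE.
under eq_bigr => i _ do rewrite sumrB big_split -!mulr_sumr.
rewrite sumrB big_split /= -!mulr_suml -mulr_sumr -mulr_suml.
set X := \sum_(i | P i) _; set Y := \sum_(i | P i) _; set Z := \sum_(i | P i) _.
lra.
Qed.

Lemma normc_sum (R : rcfType) (I : finType) (P : pred I) (f : I -> R[i]) :
  normc (\sum_(i | P i) f i) <= \sum_(i | P i) normc (f i).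
Proof.
apply: (big_ind2 (fun x y => normc x <= y)) => //.
  by rewrite ComplexField.Normc.normc0.
by move=> x1 x2 y1 y2 h1 h2; apply: le_trans (le_normcD _ _) (lerD h1 h2).
Qed.

Lemma ReM_real (R : rcfType) (z : R[i]) (a : R) :
  complex.Re z * a = complex.Re (z * a%:C%C).
Proof. by case: z => x y /=; rewrite mulr0 subr0. Qed.

Lemma Re_sum (R : rcfType) (I : finType) (P : pred I) (f : I -> R[i]) :
  complex.Re (\sum_(i | P i) f i) = \sum_(i | P i) complex.Re (f i).
Proof. by apply: (big_morph (@complex.Re R)) => // -[a b] [c d]. Qed.

Lemma normc_nat (R : rcfType) (n : nat) : normc (n%:R : R[i]) = n%:R.
Proof.
rewrite -(rmorph_nat (real_complex R)) /= expr0n addr0 sqrtr_sqr.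
by rewrite ger0_norm.
Qed.

(** * Duality and the two [L^2] bounds for restriction to the sphere *)

Section Restriction.
Variables (R : realType) (F : finFieldType) (psi : F -> R[i]).
Hypotheses (psiD : forall x y, psi (x + y) = psi x * psi y)
  (psiJ : forall x, psi x * conjc (psi x) = 1)
  (psi_nontrivial : exists x, psi x != 1).
Variable d : nat.
Local Notation q := (#|F|).
Local Notation V := ('rV[F]_d).

Definition fourier (g : V -> R) (x : V) : R[i] :=
  \sum_m (g m)%:C%C * psi (dotF m x).

Definition ext (f : V -> R[i]) (m : V) : R[i] :=
  (#|S0 F d|%:R)^-1 * \sum_(x in S0 F d) f x * psi (dotF m x).

Definition sqL2 (f : V -> R[i]) : R :=
  (#|S0 F d|%:R)^-1 * \sum_(x in S0 F d) normc (f x) ^+ 2.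

Lemma dotFB (m m' x : V) : dotF (m - m') x = dotF m x - dotF m' x.
Proof.
by rewrite /dotF -sumrB; apply: eq_bigr => i _; rewrite !mxE mulrBl.
Qed.

Lemma sum_sqr_fourier (A : {set V}) (K : V -> R) (g : V -> R) :
  (forall m, \sum_(x in A) psi (dotF m x) = (K m)%:C%C) ->
  \sum_(x in A) normc (fourier g x) ^+ 2 =
  \sum_m \sum_m' g m * g m' * K (m - m').
Proof.
move=> hK; apply: complexI; rewrite !rmorph_sum /=.
under eq_bigr => x _ do rewrite sqr_normc /fourier rmorph_sum /= mulr_suml.
rewrite exchange_big /=; apply: eq_bigr => m _.
under eq_bigr => x _ do rewrite mulr_sumr.
rewrite exchange_big /= rmorph_sum; apply: eq_bigr => m' _.
rewrite !rmorphM /= -hK mulr_sumr; apply: eq_bigr => x _.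
rewrite dotFB psiD (psiN psiD psiJ) rmorphM /= oppr0.
by rewrite [LHS]mulrACA.
Qed.

(** Extension is dual to restricting [fourier g] to the sphere; Cauchy-Schwarz on the sphere then
    separates [f] from [g]. *)
Lemma ext_fourier (f : V -> R[i]) (g : V -> R) :
  (\sum_m complex.Re (ext f m) * g m) ^+ 2 <= sqL2 f * sqL2 (fourier g).
Proof.
have c0 : 0 <= (#|S0 F d|%:R)^-1 :> R by rewrite invr_ge0.
have -> : \sum_m complex.Re (ext f m) * g m =
    complex.Re ((#|S0 F d|%:R)^-1 * \sum_(x in S0 F d) f x * fourier g x).
  under eq_bigr do rewrite ReM_real; rewrite -Re_sum; congr complex.Re.
  rewrite /ext; under eq_bigr do rewrite -mulrA mulr_suml.
  rewrite -mulr_sumr exchange_big /=; congr (_ * _).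
  apply: eq_bigr => x _; rewrite /fourier mulr_sumr; apply: eq_bigr => m _.
  by rewrite -mulrA [psi _ * _]mulrC.
set z := (X in complex.Re X).
apply: (@le_trans _ _ (normc z ^+ 2)).
  by rewrite -(real_normK (num_real _)) lerXn2r ?nnegrE ?normc_ge0 ?normc_Re.
have zle : normc z <= (#|S0 F d|%:R)^-1 *
    \sum_(x in S0 F d) normc (f x) * normc (fourier g x).
  rewrite /z ComplexField.Normc.normcM ComplexField.Normc.normcV normc_nat.
  apply: ler_wpM2l => //; apply: le_trans (normc_sum _ _) _.
  by apply: ler_sum => x _; rewrite ComplexField.Normc.normcM.
apply: (le_trans (lerXn2r 2 _ _ zle)); rewrite ?nnegrE ?normc_ge0 //.
  by rewrite mulr_ge0 // sumr_ge0 // => x _; rewrite mulr_ge0 ?normc_ge0.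
rewrite exprMn /sqL2 [leRHS]mulrACA -expr2.
by apply: ler_wpM2l; rewrite ?sqr_ge0 //; apply: cauchy_schwarz.
Qed.

(** Cauchy-Schwarz against the constant 1 on a space of normalized mass. *)
Lemma normc_ext (f : V -> R[i]) m : normc (ext f m) ^+ 2 <= sqL2 f.
Proof.
have c0 : 0 <= (#|S0 F d|%:R)^-1 :> R by rewrite invr_ge0.
have le : normc (ext f m) <= (#|S0 F d|%:R)^-1 *
    \sum_(x in S0 F d) normc (f x) * 1.
  rewrite /ext ComplexField.Normc.normcM ComplexField.Normc.normcV normc_nat.
  apply: ler_wpM2l => //; apply: le_trans (normc_sum _ _) _.
  by apply: ler_sum => x _; rewrite ComplexField.Normc.normcM (normc_psi psiJ).
apply: (le_trans (lerXn2r 2 _ _ le)); rewrite ?nnegrE ?normc_ge0 //.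
  by rewrite mulr_ge0 // sumr_ge0 // => x _; rewrite mulr_ge0 ?normc_ge0.
rewrite exprMn; apply: (le_trans (ler_wpM2l _ (cauchy_schwarz _ _ _))).
  by rewrite sqr_ge0.
rewrite [X in _ * (_ * X)](eq_bigr (fun=> 1)) => [|x _]; last by rewrite expr1n.
rewrite sumr_const /sqL2 expr2 -mulrA ler_wpM2l // mulrCA -[leRHS]mulr1.
apply: ler_wpM2l; first by rewrite sumr_ge0 // => x _; rewrite sqr_ge0.
by have [->|n0] := eqVneq #|S0 F d| 0%N; rewrite ?mulr0 // mulVf // pnatr_eq0.
Qed.

Lemma extZ (c : R[i]) (f : V -> R[i]) m :
  ext (fun x => c * f x) m = c * ext f m.
Proof.
rewrite /ext mulrCA; congr (_ * _); rewrite mulr_sumr.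
by apply: eq_bigr => x _; rewrite mulrA.
Qed.

Lemma sqL2Z (c : R[i]) (f : V -> R[i]) :
  sqL2 (fun x => c * f x) = normc c ^+ 2 * sqL2 f.
Proof.
rewrite /sqL2 mulrCA; congr (_ * _); rewrite mulr_sumr.
by apply: eq_bigr => x _; rewrite ComplexField.Normc.normcM exprMn.
Qed.

Hypotheses (two_neq0 : 2 != 0 :> F) (q_mod4 : (q %% 4 = 3)%N).
Variable l : nat.
Hypotheses (dl : d = (l.*2.+1).*2) (l_gt0 : (0 < l)%N).
Local Notation qe := (q%:R ^+ l.*2.+1 : R).

Let q_ge2 : 2 <= q%:R :> R.
Proof. by rewrite ler_nat finNzRing_gt1. Qed.

Let qe_ge : q%:R ^+ 2 <= qe.
Proof. by rewrite ler_weXn2l ?(le_trans _ q_ge2) ?ler1n //; lia. Qed.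

(** The value of [fourier_S0] divided by [q], as a real number; here [qe ^+ 2] is [q^d]. *)
Let Kernel (m : V) : R :=
  (qe ^+ 2 *+ (m == 0) - qe * (q%:R *+ (m \in S0 F d) - 1)) / q%:R.

Let KernelE (m : V) : \sum_(x in S0 F d) psi (dotF m x) = (Kernel m)%:C%C.
Proof.
have q0 : q%:R != 0 :> R[i] by rewrite pnatr_eq0; have := finNzRing_gt1 F; lia.
apply: (mulfI q0); rewrite (fourier_S0 psiD psiJ psi_nontrivial _ _ dl) //.
rewrite -[in RHS](rmorph_nat (real_complex R)) -rmorphM /= [q%:R * _]mulrC mulfVK; last first.
  by have := q_ge2; lra.
rewrite rmorphB rmorphM rmorphB !rmorphMn !rmorphXn !rmorph_nat /=.
by rewrite rmorph1 -exprM muln2 -[in RHS]dl.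
Qed.

(** The kernel at 0 gives [|S0| = (qe^2 - qe (q - 1)) / q]. As [l >= 1] forces
    [qe >= q^2 >= 2 (q - 1)], the subtracted term is at most half of the main one. *)
Lemma inv_card_S0_le : (#|S0 F d|%:R)^-1 <= 2 * q%:R / qe ^+ 2.
Proof.
have S0in : 0 \in S0 F d.
  by rewrite inE big1 // => i _; rewrite mxE expr0n.
have -> : #|S0 F d|%:R = Kernel 0.
  apply: complexI; rewrite -KernelE rmorph_nat.
  rewrite (eq_bigr (fun=> 1)) ?sumr_const // => x _.
  by rewrite /dotF big1 ?(psi0 psiD psiJ) // => i _; rewrite mxE mul0r.
rewrite /Kernel eqxx S0in !mulr1n.
have Q0 : 0 < qe by have := q_ge2; have := qe_ge; nra.
have q0 : 0 < q%:R :> R by have := q_ge2; lra.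
rewrite -[leRHS]invrK lef_pV2 ?posrE; first last.
- by rewrite invr_gt0 divr_gt0 ?exprn_gt0 // mulr_gt0.
- rewrite divr_gt0 //; have := q_ge2; have := qe_ge; nra.
rewrite invf_div invfM mulrA ler_pM2r ?invr_gt0 //.
rewrite ler_pdivrMr //; have := q_ge2; have := qe_ge; nra.
Qed.

Lemma sqL2_fourier_le (g : V -> R) :
  sqL2 (fourier g) <= 2 * q%:R * \sum_m g m ^+ 2.
Proof.
have Q0 : 0 < qe by have := q_ge2; have := qe_ge; nra.
have q0 : 0 < q%:R :> R by have := q_ge2; lra.
have G0 : 0 <= \sum_m g m ^+ 2 by apply: sumr_ge0 => m _; apply: sqr_ge0.
have le : \sum_(x in S0 F d) normc (fourier g x) ^+ 2 <=
    qe ^+ 2 * \sum_m g m ^+ 2.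
  (* The sphere is enlarged to the whole space, where Plancherel applies: the kernel becomes [q^d]
     on the diagonal. *)
  apply: (@le_trans _ _ (\sum_(x in finset.setTfor V) normc (fourier g x) ^+ 2)).
    rewrite [leRHS](bigID (mem (S0 F d))) /= -[leLHS]addr0 lerD //.
      by rewrite le_eqVlt; apply/orP; left; apply/eqP/eq_bigl => x; rewrite finset.in_setT.
    by apply: sumr_ge0 => x _; apply: sqr_ge0.
  rewrite (@sum_sqr_fourier _ (fun m => qe ^+ 2 *+ (m == 0))) => [|m]; last first.
    rewrite (eq_bigl predT) => [|x]; last by rewrite finset.in_setT.
    rewrite (sum_psi_dot psiD psiJ psi_nontrivial) rmorphMn !rmorphXn rmorph_nat.
    by rewrite -exprM muln2 -dl; case: (m == 0).
  rewrite mulr_sumr; apply: ler_sum => m _.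
  rewrite (bigD1 m) //= subrr eqxx big1 => [|m' mm'].
    by rewrite mulr1n addr0 -expr2 mulrC.
  by rewrite subr_eq0 eq_sym (negPf mm') mulr0.
apply: (le_trans (ler_wpM2l _ le)); first by rewrite invr_ge0.
apply: (le_trans (ler_wpM2r _ inv_card_S0_le)).
  by rewrite mulr_ge0 // sqr_ge0.
by rewrite mulrA mulfVK // expf_neq0 // gt_eqF.
Qed.

Lemma sqL2_fourier_le_pos (g : V -> R) : (forall m, 0 <= g m) ->
  sqL2 (fourier g) <= 2 * (\sum_m g m ^+ 2 + qe^-1 * (\sum_m g m) ^+ 2).
Proof.
move=> g0.
have Q0 : 0 < qe by have := q_ge2; have := qe_ge; nra.
have q0 : 0 < q%:R :> R by have := q_ge2; lra.
have le : \sum_(x in S0 F d) normc (fourier g x) ^+ 2 <=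
    (qe ^+ 2 * \sum_m g m ^+ 2 + qe * (\sum_m g m) ^+ 2) / q%:R.
  rewrite (sum_sqr_fourier _ KernelE) [(\sum_m g m) ^+ 2]expr2 !mulr_suml.
  rewrite !mulr_sumr -big_split mulr_suml; apply: ler_sum => m _ /=.
  (* The term of the kernel supported on S0 is negative and is dropped; this is
     where [0 <= g] is needed. *)
  apply: (@le_trans _ _ (\sum_m'
      g m * g m' * ((qe ^+ 2 *+ (m - m' == 0) + qe) / q%:R))).
    apply: ler_sum => m' _; apply: ler_wpM2l; first by rewrite mulr_ge0.
    apply: ler_wpM2r; first by rewrite invr_ge0 ltW.
    rewrite lerD2l; case: (_ \in _); rewrite ?mulr1n ?mulr0n; nra.
  under [leLHS]eq_bigr => m' _ do rewrite mulrA mulrDr mulrDl.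
  rewrite big_split /= (bigD1 m) //= subrr eqxx big1 ?addr0 => [|m' mm']; last first.
    by rewrite subr_eq0 eq_sym (negPf mm') mulr0 mul0r.
  rewrite mulrDl lerD //; first by rewrite mulr1n -expr2 [qe ^+ 2 * _]mulrC.
  by rewrite -!mulr_suml -mulr_sumr [qe * _]mulrC.
apply: (le_trans (ler_wpM2l _ le)); first by rewrite invr_ge0.
apply: (le_trans (ler_wpM2r _ inv_card_S0_le)).
  rewrite divr_ge0 ?(ltW q0) // addr_ge0 // mulr_ge0 ?sqr_ge0 ?(ltW Q0) //.
  by apply: sumr_ge0 => m _; apply: sqr_ge0.
by rewrite le_eqVlt; apply/orP; left; apply/eqP; field; rewrite !gt_eqF.
Qed.

End Restriction.

(** * Interpolation by cutting at a level *)

Lemma split_bound (R : realFieldType) (x y b : R) : 0 <= x -> 0 <= y -> 0 <= b ->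
  x ^+ 2 <= 2 * (x + y + x ^+ 2 / 16) -> y ^+ 2 <= 2 * b * (x + y) ->
  x + y <= 6 * (b + 1).
Proof.
(* Put [W = x + y]. Absorbing [x^2 / 8] on the left gives [x^2 <= 16/7 W], so
   [W^2 <= 2 x^2 + 2 y^2 <= (32/7 + 4 b) W], and one factor [W] cancels. *)
move=> x0 y0 b0 hx hy; have [|W0] := lerP (x + y) 0; first by nra.
rewrite -(ler_pM2l W0).
have : 0 <= (x - y) ^+ 2 by apply: sqr_ge0.
have : 0 <= b * (x + y) by rewrite mulr_ge0 ?addr_ge0.
by move: hx hy; lra.
Qed.

Section Interpolation.
Variables (R : realType) (a : R).
Hypothesis a_gt0 : 0 < a.

(** The positive part to the power [2 + a], with the square kept apart because pairing [u] with
    [v^(1+a)] produces [u v = v^2]. *)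
Definition pospow (x : R) : R := Num.max x 0 ^+ 2 * Num.max x 0 `^ a.

Lemma pospow_ge0 x : 0 <= pospow x.
Proof. by rewrite mulr_ge0 ?sqr_ge0 ?powR_ge0. Qed.

Lemma pospow_sum (T : finType) (u : T -> R) (q s : R) :
  0 < q -> 0 < s -> q * s `^ a = 1 -> (forall m, u m <= 1) ->
  (forall g : T -> R, (forall m, 0 <= g m) ->
    (\sum_m u m * g m) ^+ 2 <=
      2 * (\sum_m g m ^+ 2 + s ^+ 2 * (\sum_m g m) ^+ 2)) ->
  (forall g : T -> R, (\sum_m u m * g m) ^+ 2 <= 2 * q * \sum_m g m ^+ 2) ->
  \sum_m pospow (u m) <= 6 * (4 `^ a + 1).
Proof.
move=> q0 s0 qs u1 hB hC; set tau := 4 * s.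
(* The level is a multiple of [s] so that [q tau^a = 4^a] is free of [q]; the factor 4 makes the
   [l^1] term at most [X1^2 / 16], which [split_bound] absorbs. *)
have tau0 : 0 < tau by rewrite mulr_gt0.
have taua : q * tau `^ a = 4 `^ a by rewrite powRM ?(ltW s0) // mulrCA qs mulr1.
pose v m := Num.max (u m) 0; pose w m := v m `^ a.
have v0 m : 0 <= v m by rewrite le_max lexx orbT.
have v1 m : v m <= 1 by rewrite ge_max u1 ler01.
have w0 m : 0 <= w m by apply: powR_ge0.
have wle m b : v m <= b -> w m <= b `^ a.
  move=> vb; apply: (ge0_ler_powR (ltW a_gt0)); rewrite ?nnegrE ?v0 //.
  exact: le_trans (v0 m) vb.
have w1 m : w m <= 1 by have := wle _ _ (v1 m); rewrite powR1.
have uv m : u m * v m = v m ^+ 2.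
  rewrite /v; case: (lerP 0 (u m)) => _; first by rewrite expr2.
  by rewrite mulr0 expr0n.
have ppE m : pospow (u m) = v m ^+ 2 * w m by [].
(* [u * g1 = v^(2+a)] above the level [tau], [u * g2 = v^(2+a)] below it. *)
pose P m := tau < v m.
pose W := \sum_m pospow (u m).
pose X1 := \sum_(m | P m) v m ^+ 2 * w m.
pose X2 := \sum_(m | ~~ P m) v m ^+ 2 * w m.
pose g1 m := if P m then v m * w m else 0.
pose g2 m := if P m then 0 else v m * w m.
have WE : W = X1 + X2 by rewrite /W (bigID P).
have ug1 : \sum_m u m * g1 m = X1.
  rewrite /X1 [RHS]big_mkcond; apply: eq_bigr => m _; rewrite /g1.
  by case: ifP => _; rewrite ?mulr0 // mulrA uv.
have ug2 : \sum_m u m * g2 m = X2.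
  rewrite /X2 [RHS]big_mkcond; apply: eq_bigr => m _; rewrite /g2.
  by case: ifP => _; rewrite ?mulr0 //= mulrA uv.
have X10 : 0 <= X1 by apply: sumr_ge0 => m _; rewrite mulr_ge0 ?sqr_ge0.
have X20 : 0 <= X2 by apply: sumr_ge0 => m _; rewrite mulr_ge0 ?sqr_ge0.
have g10 m : 0 <= g1 m by rewrite /g1; case: ifP => // _; rewrite mulr_ge0.
have g1sq : \sum_m g1 m ^+ 2 <= W.
  apply: ler_sum => m _; rewrite /g1; case: ifP => _; last first.
    by rewrite expr0n pospow_ge0.
  rewrite exprMn ppE; apply: ler_wpM2l; first exact: sqr_ge0.
  by have := w0 m; have := w1 m; nra.
have g2sq : \sum_m g2 m ^+ 2 <= tau `^ a * W.
  rewrite mulr_sumr; apply: ler_sum => m _; rewrite /g2; case: ifPn => [_|].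
    by rewrite expr0n mulr_ge0 ?powR_ge0 ?pospow_ge0.
  rewrite -leNgt => /wle wt; rewrite exprMn ppE [leRHS]mulrCA.
  apply: ler_wpM2l; first exact: sqr_ge0.
  rewrite expr2; by apply: ler_wpM2r.
pose Y := \sum_m g1 m.
have Y0 : 0 <= Y by apply: sumr_ge0.
(* Chebyshev's argument: on the support of [g1] the level [tau] lies below [v]. *)
have YX : tau * Y <= X1.
  rewrite mulr_sumr -ug1; apply: ler_sum => m _; rewrite /g1.
  case: ifP => [Pm|_]; last by rewrite !mulr0.
  rewrite [leRHS]mulrA uv mulrA; apply: ler_wpM2r => //.
  by rewrite expr2; apply: ler_wpM2r => //; apply: ltW.
have := hB g1 g10; rewrite ug1 -/Y => h1.
have := hC g2; rewrite ug2 => h2.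
have h2' : X2 ^+ 2 <= 2 * 4 `^ a * W.
  apply: (le_trans h2); rewrite -taua -!mulrA; apply: ler_wpM2l => //.
  by apply: ler_wpM2l => //; apply: ltW.
have h1' : X1 ^+ 2 <= 2 * (W + X1 ^+ 2 / 16).
  apply: (le_trans h1); apply: ler_wpM2l => //; apply: lerD => //.
  have : (tau * Y) ^+ 2 <= X1 ^+ 2.
    by rewrite lerXn2r ?nnegrE // mulr_ge0 // ltW.
  by rewrite /tau !exprMn; lra.
have b0 : 0 <= 4 `^ a :> R by apply: powR_ge0.
rewrite -/W WE; rewrite WE in h1' h2'.
exact: (split_bound X10 X20 b0 h1' h2').
Qed.

(** The larger, [M], of the absolute real and imaginary parts satisfies [|z| <= 2 M], which costs
    [2^(2+a) = 4 * 2^a]; the power [M^(2+a)] is one of the four [pospow] terms, according to its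
    sign. *)
Lemma normc_pospow (z : R[i]) :
  normc z ^+ 2 * normc z `^ a <= 4 * 2 `^ a *
    (pospow (complex.Re z) + pospow (- complex.Re z) +
     (pospow (complex.Im z) + pospow (- complex.Im z))).
Proof.
have H M (t1 t2 t3 t4 : R) : 0 <= M -> 0 <= t1 -> 0 <= t2 -> 0 <= t3 ->
    0 <= t4 -> M ^+ 2 * M `^ a <= t1 + t2 + (t3 + t4) -> normc z <= 2 * M ->
    normc z ^+ 2 * normc z `^ a <= 4 * 2 `^ a * (t1 + t2 + (t3 + t4)).
  move=> M0 h1 h2 h3 h4 hM hz.
  apply: (@le_trans _ _ ((2 * M) ^+ 2 * (2 * M) `^ a)).
    apply: ler_pM; rewrite ?sqr_ge0 ?powR_ge0 //.
      by rewrite lerXn2r ?nnegrE ?normc_ge0 ?mulr_ge0.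
    by apply: (ge0_ler_powR (ltW a_gt0)); rewrite ?nnegrE ?normc_ge0 ?mulr_ge0.
  rewrite exprMn powRM // mulrACA (_ : 2 ^+ 2 = 4); last by ring.
  by apply: ler_wpM2l => //; rewrite mulr_ge0 ?powR_ge0.
have ppE x : `|x| ^+ 2 * `|x| `^ a <= pospow x + pospow (- x).
  have [x0|x0] := lerP 0 x.
    by rewrite ger0_norm // {1}/pospow (max_idPl x0) lerDl pospow_ge0.
  have xN : 0 <= - x by rewrite oppr_ge0 ltW.
  by rewrite ltr0_norm // /pospow (max_idPl xN) lerDr -/(pospow x) pospow_ge0.
have zle : normc z <= `|complex.Re z| + `|complex.Im z|.
  case: z {H} => x y /=; rewrite -(@ler_pXn2r _ 2) ?nnegrE ?sqrtr_ge0 ?addr_ge0 //.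
  rewrite sqr_sqrtr ?addr_ge0 ?sqr_ge0 // sqrrD !real_normK ?num_real //.
  by have := normr_ge0 x; have := normr_ge0 y; nra.
have hx := ppE (complex.Re z); have hy := ppE (complex.Im z).
have p1 := pospow_ge0 (complex.Re z); have p2 := pospow_ge0 (- complex.Re z).
have p3 := pospow_ge0 (complex.Im z); have p4 := pospow_ge0 (- complex.Im z).
case: (lerP `|complex.Re z| `|complex.Im z|) => h.
  by apply: (H `|complex.Im z|) => //; lra.
by apply: (H `|complex.Re z|) => //; lra.
Qed.

End Interpolation.

(** * The extension estimate with an explicit constant *)

Section Main.
Variables (R : realType) (F : finFieldType) (psi : F -> R[i]).
Hypotheses (psiD : forall x y, psi (x + y) = psi x * psi y)
  (psiJ : forall x, psi x * conjc (psi x) = 1)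
  (psi_nontrivial : exists x, psi x != 1).
Variables (d l : nat).
Hypotheses (two_neq0 : 2 != 0 :> F) (q_mod4 : (#|F| %% 4 = 3)%N).
Hypotheses (dl : d = (l.*2.+1).*2) (l_gt0 : (0 < l)%N).

(** Chosen so that [2 + a = (2 d + 4) / d] is the endpoint exponent. *)
Let a : R := 4 / d%:R.

Let d_gt0 : 0 < d%:R :> R. Proof. by rewrite ltr0n dl. Qed.

Let a_gt0 : 0 < a. Proof. by rewrite divr_gt0. Qed.

Lemma ext_pospow_sum (f : 'rV[F]_d -> R[i]) : sqL2 f <= 1 ->
  \sum_m pospow a (complex.Re (ext psi f m)) <= 6 * (4 `^ a + 1).
Proof.
move=> f1; have q0 : 0 < #|F|%:R :> R by rewrite ltr0n; have := finNzRing_gt1 F; lia.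
(* This choice meets both requirements: [s^2 = q^(-d/2)] and [s^a = q^(-1)]. *)
pose s : R := #|F|%:R `^ (- (d%:R / 4)).
have s2 : s ^+ 2 = (#|F|%:R ^+ l.*2.+1)^-1.
  rewrite -powR_mulrn ?powR_ge0 // -powRrM -powR_invn ?(ltW q0) //; congr powR.
  by rewrite dl -muln2 natrM; field.
apply: (@pospow_sum R a a_gt0 _ _ #|F|%:R s) => //.
- exact: powR_gt0.
- rewrite -powRrM (_ : _ * a = -1); first by rewrite powR_inv1 ?divff ?gt_eqF // ltW.
  by rewrite /a; field; rewrite gt_eqF.
- move=> m; apply: le_trans (ler_norm _) _; apply: le_trans (normc_Re _) _.
  rewrite -(@ler_pXn2r _ 2) ?nnegrE ?normc_ge0 // expr1n.
  exact: le_trans (normc_ext psiJ f m) f1.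
- move=> g g0; apply: (le_trans (ext_fourier psi f g)).
  rewrite s2; apply: le_trans (ler_wpM2r _ f1) _.
    by rewrite mulr_ge0 ?invr_ge0 // sumr_ge0 // => x _; rewrite sqr_ge0.
  rewrite mul1r.
  exact: (sqL2_fourier_le_pos psiD psiJ psi_nontrivial two_neq0 q_mod4 dl).
- move=> g; apply: (le_trans (ext_fourier psi f g)).
  apply: le_trans (ler_wpM2r _ f1) _.
    by rewrite mulr_ge0 ?invr_ge0 // sumr_ge0 // => x _; rewrite sqr_ge0.
  rewrite mul1r.
  exact: (sqL2_fourier_le psiD psiJ psi_nontrivial two_neq0 q_mod4 dl).
Qed.

Lemma ext_normc_sum (f : 'rV[F]_d -> R[i]) : sqL2 f <= 1 ->
  \sum_m normc (ext psi f m) ^+ 2 * normc (ext psi f m) `^ a <=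
  96 * 2 `^ a * (4 `^ a + 1).
Proof.
move=> f1.
have rot c : normc c = 1 ->
    \sum_m pospow a (complex.Re (c * ext psi f m)) <= 6 * (4 `^ a + 1).
  move=> c1; under eq_bigr do rewrite -extZ; apply: ext_pospow_sum.
  by rewrite sqL2Z c1 expr1n mul1r.
apply: le_trans (ler_sum _ (fun m _ => normc_pospow a_gt0 (ext psi f m))) _.
rewrite -mulr_sumr !big_split /=.
have E1 := rot 1 (ComplexField.Normc.normc1 R).
have E2 := rot (-1); have E3 := rot (- 'i)%C; have E4 := rot 'i%C.
have hi : normc ('i%C : R[i]) = 1 by rewrite /= expr0n expr1n add0r sqrtr1.
rewrite normcN ComplexField.Normc.normc1 in E2.
rewrite normcN in E3.
have := E1; have := E2 erefl; have := E3 hi; have := E4 hi.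
have s1 : \sum_m pospow a (complex.Re (1 * ext psi f m)) =
   \sum_m pospow a (complex.Re (ext psi f m)).
  by under eq_bigr do rewrite mul1r.
have s2 : \sum_m pospow a (complex.Re (-1 * ext psi f m)) =
   \sum_m pospow a (- complex.Re (ext psi f m)).
  by apply: eq_bigr => m _; rewrite mulN1r; case: (ext psi f m).
have s3 : \sum_m pospow a (complex.Re (- 'i%C * ext psi f m)) =
   \sum_m pospow a (complex.Im (ext psi f m)).
  apply: eq_bigr => m _; case: (ext psi f m) => x y /=; congr pospow; ring.
have s4 : \sum_m pospow a (complex.Re ('i%C * ext psi f m)) =
   \sum_m pospow a (- complex.Im (ext psi f m)).
  apply: eq_bigr => m _; case: (ext psi f m) => x y /=; congr pospow; ring.
rewrite s1 s2 s3 s4 => h4 h3 h2 h1.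
(* Four rotations, each bounded by [6 (4^a + 1)], account for 24. *)
rewrite (_ : 96 * _ * _ = 4 * 2 `^ a * (24 * (4 `^ a + 1))); last by ring.
by apply: ler_wpM2l; [rewrite mulr_ge0 ?powR_ge0 | lra].
Qed.

Definition restriction_const : R := 96 * 2 `^ a * (4 `^ a + 1).

(** This lets one constant serve every [r]: it dominates its own [r]-th root, and also the pointwise
    bound 1 when [r] is infinite. *)
Lemma restriction_const_ge1 : 1 <= restriction_const.
Proof.
have : 1 <= 2 `^ a :> R by rewrite -[leLHS](powRr0 2) ler_powR ?ler1n // ltW.
have : 1 <= 4 `^ a :> R by rewrite -[leLHS](powRr0 4) ler_powR ?ler1n // ltW.
by rewrite /restriction_const; nra.
Qed.

Lemma Lr_ext_unit (f : 'rV[F]_d -> R[i]) (r : \bar R) :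
  sqL2 f <= 1 -> ((2 + a)%:E <= r)%E ->
  Lr_count r (ext psi f) <= restriction_const.
Proof.
move=> f1; have C1 := restriction_const_ge1.
have n1 m : normc (ext psi f m) <= 1.
  rewrite -(@ler_pXn2r _ 2) ?nnegrE ?normc_ge0 // expr1n.
  exact: le_trans (normc_ext psiJ f m) f1.
case: r => [r| |] //=; last first.
  move=> _; apply: le_trans C1; apply/bigmax_leP; split=> // m _.
rewrite lee_fin => r2; have r_gt0 : 0 < r by move: a_gt0; lra.
have : \sum_m normc (ext psi f m) `^ r <= restriction_const.
  apply: le_trans (ext_normc_sum f1); apply: ler_sum => m _.
  have [->|n0] := eqVneq (normc (ext psi f m)) 0.
    by rewrite powR0 ?gt_eqF // mulr_ge0 ?powR_ge0 ?sqr_ge0.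
  have np : 0 < normc (ext psi f m) by rewrite lt_def n0 normc_ge0.
  rewrite -powR_mulrn ?normc_ge0 // -powRD ?n0 ?implybT //.
  by apply: ger_powR; rewrite ?np ?n1.
move=> le; apply: (@le_trans _ _ (restriction_const `^ r^-1)).
  apply: ge0_ler_powR; rewrite ?nnegrE ?invr_ge0 ?(ltW r_gt0) //.
    by apply: sumr_ge0 => m _; apply: powR_ge0.
  exact: le_trans ler01 C1.
apply: ler1_powR => //; rewrite invf_le1 //; move: a_gt0; lra.
Qed.

Lemma Lr_count_scale (g : 'rV[F]_d -> R[i]) (c : R) (r : \bar R) : 0 <= c ->
  (0 < r)%E ->
  Lr_count r (fun m => c%:C%C * g m) = c * Lr_count r g.
Proof.
move=> c0; have E m : normc (c%:C%C * g m) = c * normc (g m).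
  by rewrite ComplexField.Normc.normcM /= expr0n addr0 sqrtr_sqr ger0_norm.
case: r => [r| |] //=; last first.
  move=> _; rewrite (big_morph ( *%R c) (id1 := 0) (op1 := Num.max)).
  - by apply: eq_bigr => m _; rewrite E.
  - by move=> x y; rewrite maxr_pMr.
  - by rewrite mulr0.
rewrite lte_fin => r0.
under eq_bigr do rewrite E powRM ?normc_ge0 //.
rewrite -mulr_sumr powRM ?powR_ge0 //; last first.
  by apply: sumr_ge0 => m _; apply: powR_ge0.
by rewrite -powRrM divff ?gt_eqF // powRr1.
Qed.

Lemma Lr_ext (f : 'rV[F]_d -> R[i]) (r : \bar R) :
  ((2 + a)%:E <= r)%E ->
  Lr_count r (ext psi f) <= restriction_const * Num.sqrt (sqL2 f).
Proof.
move=> r2; have r0 : (0 < r)%E.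
  by apply: lt_le_trans r2; rewrite lte_fin; move: a_gt0; lra.
have C1 := restriction_const_ge1.
have s0 : 0 <= sqL2 f.
  by rewrite mulr_ge0 ?invr_ge0 // sumr_ge0 // => x _; rewrite sqr_ge0.
set N := Num.sqrt _; have N0 : 0 <= N by apply: sqrtr_ge0.
have NN : N ^+ 2 = sqL2 f by rewrite sqr_sqrtr.
(* If [N = 0], no normalization is possible, but [normc_ext] makes the extension vanish; otherwise
   [f] is divided by [N]. *)
have [Nz|Nnz] := eqVneq N 0.
  have z m : ext psi f m = (0 : R)%:C%C * ext psi f m.
    rewrite mul0r; apply: ComplexField.Normc.eq0_normc; apply/eqP.
    have := normc_ext psiJ f m; rewrite -NN Nz expr0n /=.
    by rewrite -sqrf_eq0 eq_le sqr_ge0 andbT.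
  by rewrite (funext z) Lr_count_scale // mul0r Nz mulr0.
pose f1 x := N^-1%:C%C * f x.
have -> : ext psi f = (fun m => N%:C%C * ext psi f1 m).
  apply/funext => m; rewrite extZ mulrA -rmorphM divff // mul1r //.
rewrite Lr_count_scale // mulrC; apply: ler_wpM2r => //.
apply: Lr_ext_unit => //; rewrite sqL2Z /= expr0n addr0 sqrtr_sqr.
by rewrite real_normK ?num_real // -NN -exprMn mulVf // expr1n.
Qed.

End Main.

Theorem theorem1p3 (R : realType) (k : nat) :
  (1 <= k)%N ->
  forall r : \bar R,
    (((2 * (4 * k + 2) + 4)%:R / (4 * k + 2)%:R : R)%:E <= r)%E ->
    exists C : R, 0 < C /\
      forall (p n : nat) (F : finFieldType),
        prime p -> odd p -> #|F| = (p ^ n)%N -> (p ^ n %% 4 = 3)%N ->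
        forall f : 'rV[F]_(4 * k + 2) -> R[i],
          Lr_count r (extension p n f) <= C * L2_S0 f.
Proof.
move=> k1 r hr; have dk : (4 * k + 2)%N = (k.*2.+1).*2 by lia.
(* The constant depends on [d] alone and is fixed before the field. *)
exists (restriction_const R (4 * k + 2)); split.
  exact: lt_le_trans ltr01 (restriction_const_ge1 R dk).
move=> p n F p_prime p_odd cardF mod4 f.
have n_gt0 : (0 < n)%N by case: n mod4 {cardF}.
have two : 2 != 0 :> F.
  rewrite -(dvdn_pcharf (card_finPcharP cardF p_prime)) gtnNdvd //.
  by have := prime_gt1 p_prime; case: (p) p_odd => [|[|[|]]].
have mod4F : (#|F| %% 4 = 3)%N by rewrite cardF.
have rE : (((2 + 4 / (4 * k + 2)%:R : R)%:E <= r)%E).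
  apply: le_trans hr; rewrite lee_fin; set D := (4 * k + 2)%N.
  have D0 : D%:R != 0 :> R by rewrite pnatr_eq0 /D dk.
  have -> : (2 * D + 4)%:R = 2 * D%:R + 4 :> R by rewrite natrD natrM.
  by rewrite [leRHS]mulrDl mulfK.
exact: (Lr_ext (chiD R p_prime n_gt0 cardF) (@chi_conj R F p n)
  (chi_nontrivial R p_prime n_gt0 cardF) two mod4F dk k1 f rE).
Qed.
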